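(* Let $M$ be a connected Poisson manifold with Poisson bivector $\mathbb{L}$, let $E$ (energy) and $S$ (entropy, concave) be smooth functions on $M$, and let $\Xi$ be a smooth dissipation potential on $T^*M$, satisfying the degeneracy conditions $$\mathbb{L}S_{\mathbf{x}}=0,\qquad X_\Xi^{dS}(E)=0,\qquad X_\Xi^{dE}=0 .$$ Fix a nonzero real number $e^*$, let $\Phi(\mathbf{x})=-S(\mathbf{x})+e^*E(\mathbf{x})$ be the thermodynamic potential, and let $$\Psi(\mathbf{x},\mathbf{x}^* )=\frac{1}{e^*}\,\mathbf{x}^*\cdot\mathbb{L}\Phi_{\mathbf{x}}-\Xi(\mathbf{x},\mathbf{x}^* ),$$ viewed as a function on the extended cotangent bundle $T^*M\times\mathbb{R}$ independent of the coordinate $z$ on $\mathbb{R}$. Let $\varepsilon_\Psi$ be the evolution Hamiltonian vector field of $\Psi$ on $T^*M\times\mathbb{R}$, let $\mathcal{T}^*\Phi:M\to T^*M\times\mathbb{R}$ be the first prolongation of $\Phi$, and let $\varepsilon_\Psi^{\mathcal{T}^*\Phi}:=T\pi^0_M\circ\varepsilon_\Psi\circ\mathcal{T}^*\Phi$ be the projected (GENERIC) vector field on $M$. Then $$\varepsilon_\Psi\circ\mathcal{T}^*\Phi(\mathbf{x}) = T\mathcal{T}^*\Phi\circ\varepsilon_\Psi^{\mathcal{T}^*\Phi}(\mathbf{x})\quad\text{for all }\mathbf{x}\in M$$ if and only if $\Phi$ is a solution of the Hamilton-Jacobi problem for the (evolution) Hamiltonian function $\Psi$, $$\Psi(\mathbf{x},\Phi_{\mathbf{x}}(\mathbf{x}),\Phi(\mathbf{x}))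 = -\Xi(\mathbf{x},\Phi_{\mathbf{x}})=\epsilon$$ for a constant $\epsilon$.
   Context: $T^*M\times\mathbb{R}$ has Darboux coordinates $(\mathbf{x},\mathbf{x}^*,z)$ and is a contact manifold with contact form $\eta=dz-\mathbf{x}^*\cdot d\mathbf{x}$ and Reeb field $\mathcal{R}=\nabla_z$. Subscripts denote partial derivatives. The evolution Hamiltonian vector field $\varepsilon_H$ of a function $H$ on $T^*M\times\mathbb{R}$ is defined by $\iota_{\varepsilon_H}\eta=0$ and $\iota_{\varepsilon_H}d\eta=dH-\mathcal{R}(H)\eta$, i.e. $$\varepsilon_H=H_{\mathbf{x}^*}\cdot\nabla_{\mathbf{x}}-(H_{\mathbf{x}}+\mathbf{x}^*H_z)\cdot\nabla_{\mathbf{x}^*}+(\mathbf{x}^*\cdot H_{\mathbf{x}^*})\nabla_z .$$ The projection is $\pi^0_M:T^*M\times\mathbb{R}\to M$, $(\mathbf{x},\mathbf{x}^*,z)\mapsto\mathbf{x}$; the first prolongation of $\Phi$ is $\mathcal{T}^*\Phi(\mathbf{x})=(\mathbf{x},\Phi_{\mathbf{x}}(\mathbf{x}),\Phi(\mathbf{x}))$, with tangent map $T\mathcal{T}^*\Phi:TM\to T(T^*M\times\mathbb{R})$. Since $\Psi$ is independent of $z$, $\Psi(\mathbf{x},\Phi_{\mathbf{x}},\Phi)$ means $\Psi(\mathbf{x},\Phi_{\mathbf{x}})$. The Poisson bivector $\mathbb{L}=(L^{ij})$ is related to the Poisson bracket by $\{A,B\}=A_{\mathbf{x}}\cdot\mathbb{L}B_{\mathbf{x}}$;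 thus $\mathbb{L}B_{\mathbf{x}}$ is the vector with components $L^{ij}\partial_jB$. A dissipation potential is a real-valued function $\Xi$ on $T^*M$ such that: $\Xi(\mathbf{x},0)=0$ for all $\mathbf{x}$; $\Xi(\mathbf{x},\cdot)$ reaches its minimum at $\mathbf{x}^*=0$; and $\Xi$ is convex in $\mathbf{x}^*$ in a neighborhood of $\mathbf{x}^*=0$ for all $\mathbf{x}$. For a function $F$ on $M$, $X_\Xi^{dF}:=\Xi_{\mathbf{x}^*}|_{\mathbf{x}^*=F_{\mathbf{x}}}\cdot\nabla_{\mathbf{x}}$, a vector field on $M$. Concavity of $S$ means that $S$ is a concave function of the coordinates $\mathbf{x}$ (in the charts of a fixed atlas). *)

(* Defs.v *)
From HB Require Import structures.
From mathcomp Require Export all_boot all_order all_algebra.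
From mathcomp Require Export all_classical all_reals all_analysis.

Set Implicit Arguments.
Unset Strict Implicit.
Unset Printing Implicit Defensive.

Import Order.TTheory GRing.Theory Num.Theory.
Export numFieldNormedType.Exports.

Local Open Scope classical_set_scope.
Local Open Scope ring_scope.

(* C^k and C^oo maps on an open subset U of a finite-dimensional normed space:
   all iterated directional derivatives exist and are differentiable. *)
Fixpoint Ck_on (R : realType) (V W : normedModType R) (k : nat)
    (U : set V) (f : V -> W) : Prop :=
  match k with
  | 0%N => forall x, U x -> {for x, continuous f}
  | k'.+1 => (forall x, U x -> differentiable f x) /\
             (forall v, Ck_on k' U ('D_v f))
  end.

Definition smooth_on (R : realType) (V W : normedModType R)
    (U : set V) (f : V -> W) : Prop := forall k, Ck_on k U f.

Definition dot (R : realType) (n : nat) (a b : 'rV[R]_n) : R :=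
  \sum_(i < n) a 0 i * b 0 i.

Definition grad (R : realType) (n : nat) (f : 'rV[R]_n -> R) (x : 'rV[R]_n)
  : 'rV[R]_n := \row_(i < n) 'D_(delta_mx 0 i) f x.

(* A family of charts on T with values in V.  [chart_at p] is a selected chart
   around p: tangent vectors, covectors and bivectors at p are represented by
   their components in that chart, so that bundles are plain product types;
   components in another chart are obtained from the Jacobians of the
   transition maps. *)
Record charts (R : realType) (V : normedModType R) (T : Type) := Charts {
  chart_index : Type;
  chart_dom : chart_index -> set T;
  chart_map : chart_index -> T -> V;
  chart_inv : chart_index -> V -> T;
  chart_at : T -> chart_index
}.

Definition chart_image (R : realType) (V : normedModType R) (T : Type)
    (A : charts V T) (i : chart_index A) : set V := chart_map i @` chart_dom i.

Record is_smooth_atlas (R : realType) (V : normedModType R)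
    (M : topologicalType) (A : charts V M) : Prop := IsSmoothAtlas {
  chart_dom_open : forall i : chart_index A, open (chart_dom i);
  chart_dom_at : forall p, chart_dom (chart_at A p) p;
  chart_image_open : forall i : chart_index A, open (chart_image i);
  chart_mapK : forall (i : chart_index A) p,
    chart_dom i p -> chart_inv i (chart_map i p) = p;
  chart_map_continuous : forall i : chart_index A,
    {within chart_dom i, continuous (chart_map i)};
  chart_inv_continuous : forall i : chart_index A,
    {within chart_image i, continuous (chart_inv i)};
  transition_smooth : forall i j : chart_index A,
    smooth_on (chart_map i @` (chart_dom i `&` chart_dom j))
      (chart_map j \o chart_inv i)
}.

Record manifold (R : realType) (n : nat) := Manifold {
  carrier :> topologicalType;
  atlas : charts 'rV[R]_n carrier;
  atlas_smooth : is_smooth_atlas atlas;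
  carrier_hausdorff : hausdorff_space carrier;
  carrier_second_countable : @second_countable carrier
}.

Definition smooth_function (R : realType) (V : normedModType R) (T : Type)
    (A : charts V T) (f : T -> R) : Prop :=
  forall i : chart_index A, smooth_on (chart_image i) (f \o chart_inv i).

(* A vector (p, v) of the tangent bundle: v is given in the chart at p. *)
Definition tangent (R : realType) (V : normedModType R) (T : Type)
    (A : charts V T) : Type := (T * V)%type.

Definition tangent_map (R : realType) (V V' : normedModType R) (T T' : Type)
    (A : charts V T) (A' : charts V' T') (f : T -> T') (w : tangent A)
  : tangent A' :=
  let i := chart_at A w.1 in
  let j := chart_at A' (f w.1) in
  (f w.1, 'd (chart_map j \o f \o chart_inv i) (chart_map i w.1) w.2).
Arguments tangent_map {R V V' T T'} A A' f w.

(* Jacobian at p of the change of charts from i to j.  With the row-vector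
   convention of ['J], the components at p transform as
     v_j = v_i *m jac i j p            (tangent vectors),
     a_j = a_i *m (jac j i p)^T        (covectors),
     L_j = (jac i j p)^T *m L_i *m jac i j p   (bivectors). *)
Definition jac (R : realType) (n : nat) (T : Type) (A : charts 'rV[R]_n T)
    (i j : chart_index A) (p : T) : 'M[R]_n :=
  'J (chart_map j \o chart_inv i) (chart_map i p).

Definition differential (R : realType) (n : nat) (M : manifold R n)
    (F : M -> R) (p : M) : 'rV[R]_n :=
  let i := chart_at (atlas M) p in grad (F \o chart_inv i) (chart_map i p).

(* Concavity of the coordinate expressions.  The image of a chart need not be
   convex, hence the restriction to the convex sets it contains. *)
Definition concave_in_charts (R : realType) (n : nat) (M : manifold R n)
    (S : M -> R) : Prop :=
  forall (i : chart_index (atlas M)) (D : set (convex_lmodType 'rV[R]_n)),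
    convex_set D -> D `<=` chart_image i ->
    convex_function D (fun x => - S (chart_inv i x)).

Definition cotangent (R : realType) (n : nat) (M : manifold R n) : Type :=
  (M * 'rV[R]_n)%type.

(* q.2 is a covector in the selected chart at q.1; the chart i of M induces the
   chart q |-> (x, x^* ) in which it has its components in the chart i. *)
Definition cotangent_charts (R : realType) (n : nat) (M : manifold R n)
  : charts ('rV[R]_n * 'rV[R]_n)%type (cotangent M) :=
  @Charts R ('rV[R]_n * 'rV[R]_n)%type (cotangent M)
    (chart_index (atlas M))
    (fun i q => chart_dom i q.1)
    (fun i q => (chart_map i q.1,
                 q.2 *m (jac i (chart_at (atlas M) q.1) q.1)^T))
    (fun i y => let p := chart_inv i y.1 in
                (p, y.2 *m (jac (chart_at (atlas M) p) i p)^T))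
    (fun q => chart_at (atlas M) q.1).

Definition extended_cotangent (R : realType) (n : nat) (M : manifold R n)
  : Type := (cotangent M * R)%type.

Definition extended_charts (R : realType) (n : nat) (M : manifold R n)
  : charts ('rV[R]_n * 'rV[R]_n * R)%type (extended_cotangent M) :=
  @Charts R ('rV[R]_n * 'rV[R]_n * R)%type (extended_cotangent M)
    (chart_index (cotangent_charts M))
    (fun i q => chart_dom i q.1)
    (fun i q => (chart_map i q.1, q.2))
    (fun i y => (chart_inv i y.1, y.2))
    (fun q => chart_at (cotangent_charts M) q.1).

Definition base_projection (R : realType) (n : nat) (M : manifold R n)
    (q : extended_cotangent M) : M := q.1.1.

Definition first_prolongation (R : realType) (n : nat) (M : manifold R n)
    (F : M -> R) (p : M) : extended_cotangent M :=
  ((p, differential F p), F p).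

(* In the Darboux coordinates (x, x^*, z), for eta = dz - x^* . dx, the field
   given by i_X eta = 0 and i_X d(eta) = dH - H_z eta is
     H_{x^*} . d_x - (H_x + x^* H_z) . d_{x^*} + (x^* . H_{x^*}) d_z. *)
Definition evolution_field (R : realType) (n : nat) (M : manifold R n)
    (H : extended_cotangent M -> R) (q : extended_cotangent M)
  : tangent (extended_charts M) :=
  let i := chart_at (extended_charts M) q in
  let h := H \o chart_inv i in
  let: (x, xs, z) := chart_map i q in
  let hx := grad (fun x' => h (x', xs, z)) x in
  let hxs := grad (fun xs' => h (x, xs', z)) xs in
  let hz := derive1 (fun z' => h (x, xs, z')) z in
  (q, (hxs, - (hx + hz *: xs), dot xs hxs)).

Definition projected_field (R : realType) (n : nat) (M : manifold R n)
    (H : extended_cotangent M -> R) (F : M -> R) : M -> tangent (atlas M) :=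
  tangent_map (extended_charts M) (atlas M) (@base_projection R n M)
    \o evolution_field H \o first_prolongation F.

Definition bivector_field (R : realType) (n : nat) (M : manifold R n) : Type :=
  M -> 'M[R]_n.

Definition bivector_in_chart (R : realType) (n : nat) (M : manifold R n)
    (L : bivector_field M) (i : chart_index (atlas M)) (p : M) : 'M[R]_n :=
  let J := jac (chart_at (atlas M) p) i p in J^T *m L p *m J.

(* The vector with components L^{ij} d_j B *)
Definition hamiltonian_vector (R : realType) (n : nat) (M : manifold R n)
    (L : bivector_field M) (B : M -> R) (p : M) : 'rV[R]_n :=
  differential B p *m (L p)^T.

Definition poisson_bracket (R : realType) (n : nat) (M : manifold R n)
    (L : bivector_field M) (A B : M -> R) (p : M) : R :=
  dot (differential A p) (hamiltonian_vector L B p).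

Record is_poisson (R : realType) (n : nat) (M : manifold R n)
    (L : bivector_field M) : Prop := IsPoisson {
  poisson_smooth : forall i : chart_index (atlas M),
    smooth_on (chart_image i) (bivector_in_chart L i \o chart_inv i);
  poisson_antisymmetric : forall p : M, (L p)^T = - L p;
  poisson_jacobi : forall A B C : M -> R,
    smooth_function (atlas M) A -> smooth_function (atlas M) B ->
    smooth_function (atlas M) C -> forall p : M,
    poisson_bracket L A (poisson_bracket L B C) p
    + poisson_bracket L B (poisson_bracket L C A) p
    + poisson_bracket L C (poisson_bracket L A B) p = 0
}.

Record is_dissipation_potential (R : realType) (n : nat) (M : manifold R n)
    (Xi : cotangent M -> R) : Prop := IsDissipationPotential {
  dissipation0 : forall p : M, Xi (p, 0) = 0;
  dissipation_min : forall (p : M) (a : 'rV[R]_n), Xi (p, 0) <= Xi (p, a);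
  dissipation_convex : forall p : M,
    exists N : set 'rV[R]_n,
      [/\ nbhs (0 : 'rV[R]_n) N, convex_set (N : set (convex_lmodType _)) &
          convex_function (N : set (convex_lmodType _)) (fun a => Xi (p, a))]
}.

(* X_Xi^{dF} *)
Definition dissipative_vector (R : realType) (n : nat) (M : manifold R n)
    (Xi : cotangent M -> R) (F : M -> R) (p : M) : 'rV[R]_n :=
  grad (fun a => Xi (p, a)) (differential F p).

Definition apply_field (R : realType) (n : nat) (M : manifold R n)
    (X : M -> 'rV[R]_n) (F : M -> R) (p : M) : R :=
  dot (X p) (differential F p).

Definition thermodynamic_potential (R : realType) (n : nat) (M : manifold R n)
    (E S : M -> R) (estar : R) (p : M) : R := - S p + estar * E p.

Definition generic_hamiltonian (R : realType) (n : nat) (M : manifold R n)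
    (L : bivector_field M) (Xi : cotangent M -> R) (Phi : M -> R) (estar : R)
    (q : cotangent M) : R :=
  estar^-1 * dot q.2 (hamiltonian_vector L Phi q.1) - Xi q.

Definition extend_function (R : realType) (n : nat) (M : manifold R n)
    (H : cotangent M -> R) (q : extended_cotangent M) : R := H q.1.

(* Main.v *)
(* In the Darboux coordinates induced by a chart, the two sides of the
   relatedness condition agree except for the x^*-component, where the condition
   reads - Psi_x = (Hess Phi) Psi_{x^*}. Since the Hessian is symmetric, this says
   that the gradient of x |-> Psi(x, Phi_x) vanishes. So the condition holds
   everywhere iff this function has zero differential, that is, M being
   connected, iff it is constant. The antisymmetry of L reduces it to
   - Xi(x, Phi_x). *)
Require Import Defs.
From mathcomp Require Import all_boot all_order all_algebra.
From mathcomp Require Import all_classical all_reals all_analysis.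
From mathcomp Require Import ring.

Set Implicit Arguments.
Unset Strict Implicit.
Unset Printing Implicit Defensive.

Import Order.TTheory GRing.Theory Num.Theory.
Import numFieldNormedType.Exports.
Local Open Scope classical_set_scope.
Local Open Scope ring_scope.

(** * Differentials: locality, matrix entries, gradients *)

(** A differential depends only on the germ of the map. Chart expressions simplify only near a
    point, and this is how explicit formulas replace them. *)
Lemma near_eq_is_diff (R : numFieldType) (V W : normedModType R)
    (f g : V -> W) (x : V) (df : V -> W) :
  (\near x, f x = g x) -> is_diff x f df -> is_diff x g df.
Proof.
move=> fg [dfx <-].
have gE : g \o shift x = cst (g x) + 'd f x +o_ 0 id.
  apply/eqaddoP => e e0; move: (diff_locally dfx) => /eqaddoP/(_ _ e0).
  have fgx : f x = g x by apply: nbhs_singleton fg.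
  rewrite (near_shift 0 x) subr0 in fg.
  apply: filterS2 fg => z /= fgz.
  by rewrite /= !fctE /= fgx -fgz.
have dgf : 'd g x = 'd f x :> (V -> W).
  by apply: diff_unique => //; apply: diff_continuous.
apply: DiffDef => //; apply/diff_locallyP; rewrite dgf; split => //.
exact: diff_continuous.
Qed.

Lemma differentiable_mx (R : numFieldType) (V : normedModType R) m n
    (F : V -> 'M[R]_(m, n)) (x : V) :
  (forall i j, differentiable (fun y => F y i j) x) -> differentiable F x.
Proof.
move=> dF.
have -> : F = \sum_(i < m) \sum_(j < n) (fun y => F y i j *: delta_mx i j).
  apply/funext => y; rewrite [LHS]matrix_sum_delta fct_sumE.
  by apply: eq_bigr => i _; rewrite fct_sumE.
apply: differentiable_sum => i; apply: differentiable_sum => j.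
exact: differentiableZl.
Qed.

Lemma diff_coord (R : numFieldType) (V : normedModType R) m n
    (F : V -> 'M[R]_(m, n)) (x v : V) i j :
  differentiable F x -> 'd F x v i j = 'd (fun y => F y i j) x v.
Proof.
move=> dF.
(* The entry map is packaged as a linear map, so that it is its own differential in the chain
   rule. *)
have @c : {linear 'M[R]_(m, n) -> R}.
  by exists (fun N : 'M[R]_(_, _) => N i j); do 2![eexists]; do ?[constructor];
     rewrite ?mxE// => ? *; rewrite ?mxE//; move=> ?; rewrite !mxE.
have -> : (fun y => F y i j) = c \o F by [].
have cc : continuous c by apply: coord_continuous.
have dc : is_diff (F x) c c.
  by apply: DiffDef; [exact: linear_differentiable|exact: diff_lin].
have dcE : 'd c (F x) = c :> ('M[R]_(m, n) -> R) by case: dc.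
rewrite (@diff_comp _ _ _ _ F c x dF); last by case: dc.
by rewrite /= dcE.
Qed.

Lemma diff_grad (R : realType) n (f : 'rV[R]_n -> R) x v :
  differentiable f x -> 'd f x v = dot v (grad f x).
Proof.
move=> df; rewrite {1}[v]row_sum_delta linear_sum; apply: eq_bigr => i _.
by rewrite linearZ mxE deriveE.
Qed.

(** * Mean values and the symmetry of second derivatives *)

Lemma is_derive_line (R : realType) (V W : normedModType R) (f : V -> W)
    (x v : V) (t : R) :
  differentiable f (x + t *: v) ->
  is_derive t 1 (fun s : R => f (x + s *: v)) ('D_v f (x + t *: v)).
Proof.
move=> df.
have dl : is_diff t (fun s : R => x + s *: v) (fun s => s *: v).
  have -> : (fun s : R => x + s *: v) = cst x + *:%R ^~ v by [].
  by apply: (@is_diff_eq _ _ _ _ (0 + *:%R ^~ v)); rewrite add0r.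
have dc : is_diff t (f \o (fun s : R => x + s *: v))
    ('d f (x + t *: v) \o (fun s => s *: v)).
  by apply: is_diff_comp; apply: differentiableP.
split; first by apply: diff_derivable; case: dc.
rewrite deriveE; last by case: dc.
by rewrite -[LHS]/('d (f \o _) t 1) diff_val /= scale1r deriveE.
Qed.

Lemma mean_value (R : realType) (V : normedModType R) (f : V -> R) (x v : V)
    (h : R) :
  0 <= h -> (forall t, 0 <= t <= h -> differentiable f (x + t *: v)) ->
  exists2 t, 0 <= t <= h & f (x + h *: v) - f x = h * 'D_v f (x + t *: v).
Proof.
move=> h0 df.
have dline t : 0 <= t <= h ->
    is_derive t 1 (fun s : R => f (x + s *: v)) ('D_v f (x + t *: v)).
  by move=> th; apply/is_derive_line/df.
have cline : {within `[0, h], continuous (fun s : R => f (x + s *: v))}.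
  apply: derivable_within_continuous => t.
  by rewrite in_itv /= => th; have [] := dline t th.
have dopen t : t \in `]0, h[ ->
    is_derive t 1 (fun s : R => f (x + s *: v)) ('D_v f (x + t *: v)).
  by rewrite in_itv /= => /andP[t0 th]; apply: dline; rewrite !ltW.
have [t th] := @MVT_segment R _ (fun s => 'D_v f (x + s *: v)) 0 h h0 dopen cline.
rewrite scale0r addr0 subr0 mulrC => fE; exists t => //.
Qed.

Lemma derive_shift_arg (R : realType) (V W : normedModType R) (f : V -> W)
    (c x v : V) : 'D_v (f \o shift c) x = 'D_v f (x + c).
Proof.
rewrite /derive; set F := fun h : R => _; set G := fun h : R => _.
by have -> : F = G by apply/funext => h; rewrite /F /G /= addrA.
Qed.

(** The mean value theorem is used twice: along [a] for the increment of [f] under translation by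
    [h *: b], then along [b] for ['D_a f]. *)
Lemma second_difference (R : realType) (V : normedModType R) (f : V -> R)
    (x a b : V) (h : R) :
  0 <= h ->
  (forall s t, 0 <= s <= h -> 0 <= t <= h ->
    differentiable f (x + s *: a + t *: b) /\
    differentiable ('D_a f) (x + s *: a + t *: b)) ->
  exists s t, [/\ 0 <= s <= h, 0 <= t <= h &
    f (x + h *: a + h *: b) - f (x + h *: a) - (f (x + h *: b) - f x) =
    h * (h * 'D_b ('D_a f) (x + s *: a + t *: b))].
Proof.
move=> h0 df.
have h00 : 0 <= (0 : R) <= h by rewrite lexx.
have hhh : 0 <= h <= h by rewrite h0 lexx.
have df0 s : 0 <= s <= h -> differentiable f (x + s *: a).
  by move=> sh; have [+ _] := df s 0 sh h00; rewrite scale0r addr0.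
have dfh s : 0 <= s <= h -> differentiable (f \o shift (h *: b)) (x + s *: a).
  move=> sh; apply: differentiable_comp; last by have [] := df s h sh hhh.
  by apply: differentiableD.
have [s sh gE] := @mean_value R V (f \o shift (h *: b) - f) x a h h0
  (fun s sh => differentiableB (dfh s sh) (df0 s sh)).
have [t th DE] := @mean_value R V ('D_a f) (x + s *: a) b h h0
  (fun t th => (df s t sh th).2).
exists s, t; split => //; rewrite -DE.
transitivity (h * 'D_a (f \o shift (h *: b) - f) (x + s *: a)); first exact: gE.
congr (_ * _).
rewrite deriveB; [|exact/diff_derivable/dfh|exact/diff_derivable/df0].
by rewrite derive_shift_arg.
Qed.

Lemma near_parallelogram (R : realType) (V : normedModType R) (x a b : V)
    (P : set V) :
  nbhs x P ->
  exists2 h : R, 0 < h &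
    forall s t, 0 <= s <= h -> 0 <= t <= h -> P (x + s *: a + t *: b).
Proof.
move=> /nbhs_ballP[e /= e0 eP].
(* The summand 1 keeps [c] positive when [a] and [b] vanish, and makes the final bound strict. *)
pose c := `|a| + `|b| + 1.
have c0 : 0 < c by rewrite ltr_wpDl// addr_ge0.
exists (e / c); first by rewrite divr_gt0.
move=> s t /andP[s0 sh] /andP[t0 th]; apply: eP.
rewrite -ball_normE /ball_ /= -addrA opprD addrA subrr sub0r normrN.
apply: le_lt_trans (ler_normD _ _) _; rewrite !normrZ !ger0_norm//.
have -> : e = e / c * `|a| + e / c * `|b| + e / c by rewrite /c; field; rewrite gt_eqF.
rewrite ltr_pwDr ?divr_gt0// lerD// ler_wpM2r//.
Qed.

(** The second difference over a small parallelogram is symmetric in [a] and [b]. Hence one mixed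
    derivative at some point near [x] equals the other at another such point, and by continuity they
    cannot differ at [x]. *)
Lemma derive_sym (R : realType) (V : normedModType R) (f : V -> R)
    (x a b : V) :
  (\near x, differentiable f x) ->
  (\near x, differentiable ('D_a f) x) ->
  (\near x, differentiable ('D_b f) x) ->
  {for x, continuous ('D_b ('D_a f))} ->
  {for x, continuous ('D_a ('D_b f))} ->
  'D_b ('D_a f) x = 'D_a ('D_b f) x.
Proof.
(* No point [z] is closer to both [u] and [w] than half their distance. *)
have far (u w z : R) : `|u - z| < `|u - w| / 2 -> `|w - z| < `|u - w| / 2 -> False.
  move=> uz wz; have := ler_distD z u w.
  by rewrite [`|z - w|]distrC leNgt [X in _ < X](splitr `|u - w|) ltrD.
move=> df da db cab cba; apply/eqP/negPn/negP => neq.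
pose e := `|'D_b ('D_a f) x - 'D_a ('D_b f) x| / 2.
have e0 : 0 < e by rewrite divr_gt0// normr_gt0 subr_eq0.
have nab : \forall y \near x, `|'D_b ('D_a f) x - 'D_b ('D_a f) y| < e.
  exact: cvgr_dist_lt cab _ e0.
have nba : \forall y \near x, `|'D_a ('D_b f) x - 'D_a ('D_b f) y| < e.
  exact: cvgr_dist_lt cba _ e0.
have [h h0 hP] := near_parallelogram a b
  (filterI df (filterI (filterI da db) (filterI nab nba))).
have [s [t [sh th E1]]] := @second_difference R V f x a b h (ltW h0)
  (fun s t sh th => conj (hP s t sh th).1 (hP s t sh th).2.1.1).
have hP' s' t' : 0 <= s' <= h -> 0 <= t' <= h ->
    differentiable f (x + s' *: b + t' *: a) /\
    differentiable ('D_b f) (x + s' *: b + t' *: a).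
  move=> sh' th'; rewrite [x + _ + _]addrAC.
  by have [? [[? ?] ?]] := hP t' s' th' sh'.
have [t' [s' [th' sh' E2]]] := @second_difference R V f x b a h (ltW h0) hP'.
have [_ [_ [/= n1 _]]] := hP s t sh th.
have [_ [_ [_ /= n2]]] := hP s' t' sh' th'.
rewrite addrAC in n2.
(* Both sides, multiplied by [h] twice, are the same second difference. *)
have eqd : 'D_b ('D_a f) (x + s *: a + t *: b) = 'D_a ('D_b f) (x + t' *: b + s' *: a).
  have hn0 : h != 0 by rewrite gt_eqF.
  apply/(mulfI hn0)/(mulfI hn0); rewrite -[LHS]E1 -[RHS]E2.
  by rewrite [x + h *: a + _]addrAC; ring.
by rewrite eqd in n1; exact: far n1 n2.
Qed.

(** The segment from the center to [y] stays in the ball, so the mean value theorem applies along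
    it. *)
Lemma derive_0_ball_cst (R : realType) (V : normedModType R) (f : V -> R)
    (x y : V) (e : R) :
  (forall z, ball x e z -> differentiable f z) ->
  (forall z v, ball x e z -> 'D_v f z = 0) -> ball x e y -> f y = f x.
Proof.
move=> df f0 xy.
have inb t : 0 <= t <= 1 -> ball x e (x + t *: (y - x)).
  move=> /andP[t0 t1]; move: xy; rewrite -!ball_normE /ball_ /=.
  rewrite opprD addrA subrr sub0r normrN normrZ ger0_norm// distrC.
  by apply: le_lt_trans; rewrite ler_piMl.
have [t /inb ht] := @mean_value R V f x (y - x) 1 ler01 (fun t ht => df _ (inb t ht)).
by rewrite f0// mulr0 scale1r subrKC => /subr0_eq.
Qed.

(** * Maps of class C^k and smooth maps on an open set *)

(** Openness of [U] makes the equality hold near each point, so it passes to directional derivatives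
    and the induction goes on. *)
Lemma Ck_on_eq (R : realType) (V W : normedModType R) k (U : set V)
    (f g : V -> W) :
  open U -> (forall x, U x -> f x = g x) -> Ck_on k U f -> Ck_on k U g.
Proof.
move=> oU; elim: k f g => [|k IHk] f g fg /=.
  move=> cf x Ux; have nfg : \near x, f x = g x.
    by apply: filterS (open_nbhs_nbhs (conj oU Ux)) => y; apply: fg.
  rewrite /prop_for /continuous_at -(fg _ Ux).
  by apply: cvg_trans (cf x Ux); apply: near_eq_cvg; apply: filterS nfg.
have nfg x : U x -> \near x, f x = g x.
  by move=> Ux; apply: filterS (open_nbhs_nbhs (conj oU Ux)) => y; apply: fg.
move=> [df Df]; split=> [x Ux|v].
  by have [] := near_eq_is_diff (nfg x Ux) (differentiableP (df x Ux)).
by apply: (IHk ('D_v f)) (Df v) => x Ux; apply/near_eq_derive/nfg.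
Qed.

(** The combination has the shape of the thermodynamic potential. Its directional derivatives have
    the same shape on [U], which feeds the induction through [Ck_on_eq]. *)
Lemma Ck_on_lin (R : realType) (V W : normedModType R) k (U : set V)
    (f g : V -> W) (c : R) :
  open U -> Ck_on k U f -> Ck_on k U g ->
  Ck_on k U (fun x => - f x + c *: g x).
Proof.
move=> oU; elim: k f g => [|k IHk] f g /=.
  move=> cf cg x Ux; apply: (@continuousD _ _ _ (- f) (c \*: g)).
    exact/continuousN/cf.
  exact/continuousZl_tmp/cg.
move=> [df Df] [dg Dg]; split=> [x Ux|v].
  apply: differentiableD; first exact/differentiableN/df.
  exact/differentiableZ/dg.
apply: Ck_on_eq (IHk _ _ (Df v) (Dg v)) => // x Ux.
have Df' := @diff_derivable _ _ _ f x v (df x Ux).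
have Dg' := @diff_derivable _ _ _ g x v (dg x Ux).
rewrite -[X in _ = derive X _ _]/(- f + c *: g) deriveD; last exact: derivableZ.
  by rewrite deriveN// deriveZ.
exact: derivableN.
Qed.

Section smooth_on.
Context (R : realType) (V W : normedModType R) (U : set V).
Implicit Types f g : V -> W.

Lemma smooth_on_lin f g (c : R) : open U ->
  smooth_on U f -> smooth_on U g -> smooth_on U (fun x => - f x + c *: g x).
Proof. by move=> oU sf sg k; exact: Ck_on_lin. Qed.

Lemma smooth_on_diff f x : smooth_on U f -> U x -> differentiable f x.
Proof. by move=> sf Ux; have [df _] := sf 1%N; exact: df. Qed.

Lemma smooth_on_derive f v : smooth_on U f -> smooth_on U ('D_v f).
Proof. by move=> sf k; have [_ Df] := sf k.+1; exact: Df. Qed.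

Lemma smooth_on_continuous f x : smooth_on U f -> U x -> {for x, continuous f}.
Proof. by move=> sf; exact: (sf 0%N x). Qed.
End smooth_on.

Lemma smooth_on_derive_sym (R : realType) (V : normedModType R) (U : set V)
    (f : V -> R) a b x :
  open U -> smooth_on U f -> U x -> 'D_b ('D_a f) x = 'D_a ('D_b f) x.
Proof.
move=> oU sf Ux; have nU := open_nbhs_nbhs (conj oU Ux).
have near_diff g : smooth_on U g -> \near x, differentiable g x.
  by move=> sg; apply: filterS nU => y; apply: smooth_on_diff.
have sD v : smooth_on U ('D_v f) by apply: smooth_on_derive.
apply: derive_sym; try exact: near_diff.
  exact/(smooth_on_continuous (smooth_on_derive b (sD a))).
exact/(smooth_on_continuous (smooth_on_derive a (sD b))).
Qed.

Lemma smooth_on_grad_diff (R : realType) n (U : set 'rV[R]_n)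
    (f : 'rV[R]_n -> R) x :
  smooth_on U f -> U x -> differentiable (grad f) x.
Proof.
move=> sf Ux; apply: differentiable_mx => i j.
have -> : (fun y => grad f y i j) = 'D_(delta_mx 0 j) f.
  by apply/funext => y; rewrite mxE.
exact: smooth_on_diff (smooth_on_derive _ sf) Ux.
Qed.

(** * Change of charts *)

Section charts_of_a_manifold.
Context (R : realType) (n : nat) (M : manifold R n).
Implicit Types (i j : chart_index (atlas M)) (p : M) (y : 'rV[R]_n).

Lemma chart_image_map i p : chart_dom i p -> chart_image i (chart_map i p).
Proof. by exists p. Qed.

Lemma chart_invP i p : chart_dom i p -> chart_inv i (chart_map i p) = p.
Proof. exact: (@chart_mapK _ _ _ _ (atlas_smooth M)). Qed.

Lemma chart_image_inv i y : chart_image i y ->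
  chart_dom i (chart_inv i y) /\ chart_map i (chart_inv i y) = y.
Proof. by move=> [p ip <-]; rewrite chart_invP. Qed.

Lemma near_chart_image i y : chart_image i y -> nbhs y (chart_image i).
Proof.
move=> iy; apply: open_nbhs_nbhs; split=> //.
exact: (@chart_image_open _ _ _ _ (atlas_smooth M)).
Qed.

Lemma near_chart_dom i j y : chart_image i y -> chart_dom j (chart_inv i y) ->
  \forall z \near y, chart_dom j (chart_inv i z).
Proof.
move=> iy jy.
have := @chart_inv_continuous _ _ _ _ (atlas_smooth M) i.
rewrite continuous_open_subspace; last exact: (@chart_image_open _ _ _ _ (atlas_smooth M)).
move=> /(_ y); rewrite inE => /(_ iy); apply.
apply: open_nbhs_nbhs; split => //; exact: (@chart_dom_open _ _ _ _ (atlas_smooth M)).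
Qed.

Lemma transition_diff i j p : chart_dom i p -> chart_dom j p ->
  differentiable (chart_map j \o chart_inv i) (chart_map i p).
Proof.
move=> ip jp.
apply: smooth_on_diff (@transition_smooth _ _ _ _ (atlas_smooth M) i j) _.
by exists p.
Qed.

(** Near the point, [F \o chart_inv i] factors through the transition map, because the chart domains
    are open; the chain rule then applies. *)
Lemma change_of_chart_is_diff (W : normedModType R) (F : M -> W) i j p :
  chart_dom i p -> chart_dom j p ->
  differentiable (F \o chart_inv j) (chart_map j p) ->
  is_diff (chart_map i p) (F \o chart_inv i)
    ('d (F \o chart_inv j) (chart_map j p) \o
     'd (chart_map j \o chart_inv i) (chart_map i p)).
Proof.
move=> ip jp dF.
have dt := differentiableP (transition_diff ip jp).
have dF' : is_diff ((chart_map j \o chart_inv i) (chart_map i p))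
    (F \o chart_inv j) ('d (F \o chart_inv j) (chart_map j p)).
  by rewrite /= chart_invP//; apply: differentiableP.
apply: near_eq_is_diff (is_diff_comp dt dF').
have iy := chart_image_map ip.
have /(near_chart_dom iy) : chart_dom j (chart_inv i (chart_map i p)).
  by rewrite chart_invP.
by apply: filterS => z jz /=; rewrite chart_invP.
Qed.

(** Row [k] of the Jacobian is the image of the [k]-th basis vector, so the chain rule puts its
    transpose to the right of a row gradient: the transformation law of covectors. *)
Lemma change_of_chart_grad (F : M -> R) i j p :
  chart_dom i p -> chart_dom j p ->
  differentiable (F \o chart_inv j) (chart_map j p) ->
  grad (F \o chart_inv i) (chart_map i p) =
  grad (F \o chart_inv j) (chart_map j p) *m (jac i j p)^T.
Proof.
move=> ip jp dF; have [dFi dFE] := change_of_chart_is_diff ip jp dF.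
apply/rowP => k; rewrite mxE deriveE// dFE /= diff_grad// mxE.
apply: eq_bigr => l _; rewrite [RHS]mulrC; congr (_ * _).
by rewrite !mxE.
Qed.

(** The transition map of a chart to itself is the identity on the chart image, which is a
    neighbourhood of the point. *)
Lemma jac_id i p : chart_dom i p -> jac i i p = 1%:M.
Proof.
move=> ip; rewrite /jac.
have [_ d1] : is_diff (chart_map i p) (chart_map i \o chart_inv i) id.
  apply: near_eq_is_diff (is_diff_id (chart_map i p)).
  apply: filterS (near_chart_image (chart_image_map ip)) => y iy.
  by have [_ /= ->] := chart_image_inv iy.
apply/row_matrixP => k; rewrite rowE mul_rV_lin1 d1.
by rewrite row1.
Qed.

End charts_of_a_manifold.

(** * Gradients and partial differentials on products *)

Lemma dot_mulmx (R : realType) n (a b : 'rV[R]_n) : dot a b = (a *m b^T) 0 0.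
Proof. by rewrite mxE; apply: eq_bigr => i _; rewrite mxE. Qed.

Lemma grad_cst (R : realType) n (c : R) (x : 'rV[R]_n) : grad (cst c) x = 0.
Proof. by apply/rowP => i; rewrite !mxE derive_cst. Qed.

Lemma near_eq_grad (R : realType) n (f g : 'rV[R]_n -> R) x :
  (\near x, f x = g x) -> grad f x = grad g x.
Proof. by move=> fg; apply/rowP => i; rewrite !mxE; apply: near_eq_derive. Qed.

Lemma fst_is_diff (R : numFieldType) (V W : normedModType R) (x : V * W) :
  is_diff x fst fst.
Proof.
have c : continuous (@fst V W) by move=> y; apply: cvg_fst.
by apply: DiffDef; [exact: linear_differentiable|exact: diff_lin].
Qed.

Lemma snd_is_diff (R : numFieldType) (V W : normedModType R) (x : V * W) :
  is_diff x snd snd.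
Proof.
have c : continuous (@snd V W) by move=> y; apply: cvg_snd.
by apply: DiffDef; [exact: linear_differentiable|exact: diff_lin].
Qed.

Lemma diff_partial1 (R : realType) (V V' W : normedModType R)
    (h : V * V' -> W) x a :
  differentiable h (x, a) ->
  is_diff x (fun x' => h (x', a)) (fun v => 'd h (x, a) (v, 0)).
Proof.
move=> dh.
have dp : is_diff x (fun x' : V => (x', a)) (fun v => (v, 0)).
  exact: is_diff_pair (is_diff_id x) (is_diff_cst a x).
have dh' : is_diff ((fun x' : V => (x', a)) x) h ('d h (x, a)).
  exact: differentiableP.
exact: is_diff_comp dp dh'.
Qed.

Lemma diff_partial2 (R : realType) (V V' W : normedModType R)
    (h : V * V' -> W) x a :
  differentiable h (x, a) ->
  is_diff a (fun a' => h (x, a')) (fun v => 'd h (x, a) (0, v)).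
Proof.
move=> dh.
have dp : is_diff a (fun a' : V' => (x, a')) (fun v => (0, v)).
  exact: is_diff_pair (is_diff_cst x a) (is_diff_id a).
have dh' : is_diff ((fun a' : V' => (x, a')) a) h ('d h (x, a)).
  exact: differentiableP.
exact: is_diff_comp dp dh'.
Qed.

(** Chain rule through the graph [z |-> (z, grad phi z)], the coordinate form of the section of the
    cotangent bundle given by the differential. *)
Lemma is_diff_along_grad (R : realType) n (U : set 'rV[R]_n)
    (h : 'rV[R]_n * 'rV[R]_n -> R) (phi : 'rV[R]_n -> R) y :
  smooth_on U phi -> U y -> differentiable h (y, grad phi y) ->
  is_diff y (fun z => h (z, grad phi z))
    (fun v => 'd h (y, grad phi y) (v, 'd (grad phi) y v)).
Proof.
move=> sphi Uy dh.
have dg := differentiableP (smooth_on_grad_diff sphi Uy).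
have dp := is_diff_pair (is_diff_id y) dg.
have dh' : is_diff ((fun z => (z, grad phi z)) y) h ('d h (y, grad phi y)).
  exact: differentiableP.
exact: is_diff_comp dp dh'.
Qed.

(* The symmetry of the Hessian of [phi] turns the derivative of [h_a] paired
   with [grad phi] into the derivative of [grad phi] in the direction [h_a]. *)
Lemma grad_along_grad (R : realType) n (U : set 'rV[R]_n)
    (h : 'rV[R]_n * 'rV[R]_n -> R) (phi : 'rV[R]_n -> R) y :
  open U -> smooth_on U phi -> U y -> differentiable h (y, grad phi y) ->
  grad (fun z => h (z, grad phi z)) y =
  grad (fun z => h (z, grad phi y)) y +
  'd (grad phi) y (grad (fun a => h (y, a)) (grad phi y)).
Proof.
move=> oU sphi Uy dh.
have dg := smooth_on_grad_diff sphi Uy.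
have [dhg dhgE] := is_diff_along_grad sphi Uy dh.
have [dhx dhxE] := diff_partial1 dh.
have [dha dhaE] := diff_partial2 dh.
have dD l : differentiable ('D_(delta_mx 0 l) phi) y.
  exact: smooth_on_diff (smooth_on_derive _ sphi) Uy.
have gradE l : (fun z => grad phi z 0 l) = 'D_(delta_mx 0 l) phi.
  by apply/funext => z; rewrite mxE.
set ha := grad _ (grad phi y).
apply/rowP => k; rewrite 3!mxE deriveE// dhgE deriveE// dhxE.
set w := 'd (grad phi) y _.
(* The direction splits into a base part, which gives the partial gradient in the base variable, and
   a fibre part, which carries the Hessian of [phi]. *)
have -> : (delta_mx 0 k : 'rV[R]_n, w) = (delta_mx 0 k, 0) + (0, w).
  by congr (_, _); rewrite /= ?addr0 ?add0r.
rewrite linearD; congr (_ + _).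
have -> : 'd h (y, grad phi y) (0, w) = dot w ha.
  by rewrite -[LHS](congr1 (fun F => F w) dhaE) diff_grad.
rewrite diff_coord// gradE diff_grad//; apply: eq_bigr => l _.
rewrite mulrC; congr (_ * _).
rewrite /w diff_coord// gradE -deriveE// [RHS]mxE.
exact: smooth_on_derive_sym oU sphi Uy.
Qed.

(** * Differentials of functions on the manifold *)

Section functions_on_a_manifold.
Context (R : realType) (n : nat) (M : manifold R n).
Implicit Types (i j : chart_index (atlas M)) (p x : M) (y : 'rV[R]_n).
Implicit Types (F : M -> R).

Lemma chart_dom_self p : chart_dom (chart_at (atlas M) p) p.
Proof. exact: (@chart_dom_at _ _ _ _ (atlas_smooth M)). Qed.

Definition differentiable_on_manifold F :=
  forall i y, chart_image i y -> differentiable (F \o chart_inv i) y.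

Lemma smooth_function_diff F :
  smooth_function (atlas M) F -> differentiable_on_manifold F.
Proof. by move=> sF i y; apply: smooth_on_diff. Qed.

Lemma differential_in_chart F i y (p := chart_inv i y) :
  differentiable_on_manifold F -> chart_image i y ->
  differential F p =
  grad (F \o chart_inv i) y *m (jac (chart_at (atlas M) p) i p)^T.
Proof.
move=> dF iy; have [ip py] := chart_image_inv iy.
have := change_of_chart_grad (F := F) (chart_dom_self p) ip.
by rewrite py; apply; apply: dF.
Qed.

Lemma grad_in_chart F i p : differentiable_on_manifold F -> chart_dom i p ->
  grad (F \o chart_inv i) (chart_map i p) =
  differential F p *m (jac i (chart_at (atlas M) p) p)^T.
Proof.
move=> dF ip; have pp := chart_dom_self p.
by rewrite /differential -change_of_chart_grad//; apply/dF/chart_image_map.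
Qed.

(* Every point is tested only in its own selected chart; the transition maps
   carry the vanishing of the differential over to a neighbourhood. *)
Lemma differential0_cst F : connected [set: M] ->
  differentiable_on_manifold F -> (forall p, differential F p = 0) ->
  forall p q, F p = F q.
Proof.
move=> cM dF F0 p q.
have grad0 i z : chart_image i z -> grad (F \o chart_inv i) z = 0.
  move=> iz; have [ip zE] := chart_image_inv iz.
  by rewrite -zE grad_in_chart// F0 mul0mx.
(* [F] is locally constant: a ball inside the chart image carries its coordinate expression, whose
   gradient vanishes. *)
have locc r : \forall s \near r, F s = F r.
  set i := chart_at (atlas M) r; have ir : chart_dom i r := chart_dom_self r.
  have /near_chart_image/nbhs_ballP[e /= e0 eU] := chart_image_map ir.
  have := @chart_map_continuous _ _ _ _ (atlas_smooth M) i.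
  have oi : open (chart_dom i) by apply: (@chart_dom_open _ _ _ _ (atlas_smooth M)).
  rewrite continuous_open_subspace// => /(_ r); rewrite inE => /(_ ir).
  move=> /(_ _ (nbhsx_ballx (chart_map i r) e e0)) nb.
  have no : nbhs r (chart_dom i) by apply: open_nbhs_nbhs.
  apply: (@filterS2 _ (nbhs r) _ _ _ _ _ nb no) => s /= sb si.
  rewrite -[in LHS](chart_invP si) -[in RHS](chart_invP ir).
  apply: (@derive_0_ball_cst _ _ (F \o chart_inv i) _ _ e) => //.
    by move=> z /eU; apply: dF.
  move=> z v /eU iz; rewrite deriveE; last exact: dF.
  rewrite diff_grad; last exact: dF.
  by rewrite grad0// /dot big1// => k _; rewrite mxE mulr0.
(* Every preimage under a locally constant function is open, so a level set is both open and
   closed. *)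
have openP (P : R -> Prop) : open [set r | P (F r)].
  rewrite openE => r /= Pr; apply: filterS (locc r) => s /= ->.
  exact: Pr.
have /(_ [set r | F r = F q]) E := cM.
suff : [set r | F r = F q] = [set: M] by move/seteqP => -[_ /(_ p)]; apply.
apply: E; first by exists q.
  exists [set r | F r = F q]; last by rewrite setTI.
  exact: (openP (fun c => c = F q)).
exists [set r | F r = F q]; last by rewrite setTI.
rewrite -openC; exact: (openP (fun c => c <> F q)).
Qed.

End functions_on_a_manifold.

(** * The Hamiltonian and its fields in Darboux coordinates *)

Section generic.
Context (R : realType) (n : nat) (M : manifold R n) (L : bivector_field M).
Context (Xi : cotangent M -> R) (Phi : M -> R) (e : R).
Context (L_smooth : forall i : chart_index (atlas M),
  smooth_on (chart_image i) (bivector_in_chart L i \o chart_inv i)).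
Context (Phi_smooth : smooth_function (atlas M) Phi).
Context (Xi_smooth : smooth_function (cotangent_charts M) Xi).
Implicit Types (i : chart_index (atlas M)) (p x : M) (y : 'rV[R]_n).

Let k := generic_hamiltonian L Xi Phi e.
Let Psi := extend_function k.
Let phi i := Phi \o chart_inv i.
Let Phi_diff := smooth_function_diff Phi_smooth.

(** The chart [i] stays fixed while the base point moves, whereas the selected chart may jump from
    point to point. *)
Let h i (w : 'rV[R]_n * 'rV[R]_n) : R :=
  k (@chart_inv R _ _ (cotangent_charts M) i w).

Let section_in_chart i y : chart_image i y ->
  @chart_inv R _ _ (cotangent_charts M) i (y, grad (phi i) y) =
  (chart_inv i y, differential Phi (chart_inv i y)).
Proof. by move=> iy; rewrite /= (differential_in_chart Phi_diff iy). Qed.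

Let section_image i y : chart_image i y ->
  @chart_image R _ _ (cotangent_charts M) i (y, grad (phi i) y).
Proof.
move=> iy; have [ip yE] := chart_image_inv iy.
exists (chart_inv i y, differential Phi (chart_inv i y)) => //=.
by rewrite -grad_in_chart// yE.
Qed.

(** The Jacobians from both factors combine with [L p] into the bivector in the fixed chart [i],
    whose components are smooth even where the selected chart changes. *)
Lemma reversible_part_in_chart i y a (p := chart_inv i y) :
  chart_image i y ->
  dot (a *m (jac (chart_at (atlas M) p) i p)^T) (hamiltonian_vector L Phi p) =
  dot a (grad (phi i) y *m (bivector_in_chart L i p)^T).
Proof.
move=> iy; rewrite /hamiltonian_vector (differential_in_chart Phi_diff iy).
rewrite /bivector_in_chart !dot_mulmx -/p.
by rewrite !trmx_mul !trmxK !mulmxA.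
Qed.

(** Near the point, [h i] is a multiple of [rev] minus the coordinate form of [Xi], and [rev] is
    built by sums and products from fibre coordinates, the gradient of [phi i] and bivector
    entries. *)
Lemma generic_hamiltonian_diff i y : chart_image i y ->
  differentiable (h i) (y, grad (phi i) y).
Proof.
move=> iy.
have dfst (w : 'rV[R]_n * 'rV[R]_n) : differentiable fst w.
  by have [] := fst_is_diff w.
have dsnd (w : 'rV[R]_n * 'rV[R]_n) : differentiable snd w.
  by have [] := snd_is_diff w.
pose B z := bivector_in_chart L i (chart_inv i z).
pose rev (w : 'rV[R]_n * 'rV[R]_n) :=
  \sum_(l < n) w.2 0 l * \sum_(m < n) grad (phi i) w.1 0 m * B w.1 l m.
have drev : differentiable rev (y, grad (phi i) y).
  pose c2 l (w : 'rV[R]_n * 'rV[R]_n) : R := w.2 0 l.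
  pose g1 m (w : 'rV[R]_n * 'rV[R]_n) : R := grad (phi i) w.1 0 m.
  pose B1 l m (w : 'rV[R]_n * 'rV[R]_n) : R := B w.1 l m.
  have -> : rev = \sum_(l < n) (c2 l * \sum_(m < n) (g1 m * B1 l m)).
    apply/funext => w; rewrite fct_sumE; apply: eq_bigr => l _.
    by rewrite fctE /= fct_sumE.
  apply: differentiable_sum => l; apply: differentiableM.
    apply: (@differentiable_comp _ _ _ _ snd (fun a : 'rV[R]_n => a 0 l)) => //.
    exact: differentiable_coord.
  apply: differentiable_sum => m; apply: differentiableM.
    apply: (@differentiable_comp _ _ _ _ fst (fun z => grad (phi i) z 0 m)) => //=.
    apply: (@differentiable_comp _ _ _ _ (grad (phi i)) (fun a : 'rV[R]_n => a 0 m)).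
      exact: smooth_on_grad_diff (Phi_smooth i) iy.
    exact: differentiable_coord.
  apply: (@differentiable_comp _ _ _ _ fst (fun z => B z l m)) => //=.
  apply: (@differentiable_comp _ _ _ _ B (fun A : 'M[R]_n => A l m)).
    exact: smooth_on_diff (L_smooth i) iy.
  exact: differentiable_coord.
have dXi := smooth_on_diff (Xi_smooth i) (section_image iy).
have dmain := differentiableB (differentiableZ e^-1 drev) dXi.
suff /near_eq_is_diff/(_ (differentiableP dmain))[dh _] :
    \forall w \near (y, grad (phi i) y), (e^-1 *: rev -
      (Xi \o @chart_inv R _ _ (cotangent_charts M) i)) w = h i w.
  exact: dh.
(* The formula needs only the base coordinate to lie in the chart image; the fibre coordinate is
   free. *)
have : \forall w \near (y, grad (phi i) y), chart_image i w.1.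
  by apply: (@cvg_fst _ _ (nbhs y) (nbhs (grad (phi i) y))); exact: near_chart_image.
apply: filterS => -[z a] /= iz.
have -> : h i (z, a) = e^-1 * rev (z, a) -
    Xi (@chart_inv R _ _ (cotangent_charts M) i (z, a)).
  rewrite /h /k /generic_hamiltonian /= reversible_part_in_chart// /dot.
  congr (_ * _ - _); apply: eq_bigr => l _; congr (_ * _).
  rewrite [LHS]mxE; apply: eq_bigr => m _; congr (_ * _); exact: mxE.
by [].
Qed.

Let partial_a i y := grad (fun a => h i (y, a)) (grad (phi i) y).
Let partial_x i y := grad (fun z => h i (z, grad (phi i) y)) y.

(** [Psi] does not depend on [z], so the Reeb term drops out; the covector is already expressed in
    the selected chart, so [jac_id] removes the Jacobian. *)
Lemma evolution_field_prolongation x (i := chart_at (atlas M) x)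
    (y := chart_map i x) :
  evolution_field Psi (first_prolongation Phi x) =
  (first_prolongation Phi x,
   (partial_a i y, - partial_x i y, dot (grad (phi i) y) (partial_a i y))).
Proof.
rewrite /evolution_field /= jac_id ?trmx1 ?mulmx1; last exact: chart_dom_self.
set f := (X in derive1 X).
have -> : f = cst (f 0) by [].
rewrite derive1_cst.
by rewrite scale0r addr0.
Qed.

(** In coordinates the base projection is [fst \o fst] near the point, so its tangent map keeps the
    base component. *)
Lemma projected_field_prolongation x (i := chart_at (atlas M) x) :
  projected_field Psi Phi x = (x, partial_a i (chart_map i x)).
Proof.
rewrite /projected_field [LHS]/= evolution_field_prolongation /tangent_map /=.
congr (_, _); rewrite -/i jac_id ?trmx1 ?mulmx1; last exact: chart_dom_self.
set y := chart_map i x.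
have iy : chart_image i y by apply: chart_image_map; exact: chart_dom_self.
set w := (y, _, _).
have dff : is_diff w (fst \o fst) (fst \o fst).
  by apply: is_diff_comp; [exact: fst_is_diff|exact: fst_is_diff].
set f := chart_map i \o _ \o _.
have [_ ->//] : is_diff w f (fst \o fst).
have near_i : \forall q \near w, chart_image i q.1.1.
  exact: (differentiable_continuous (@ex_diff _ _ _ _ _ _ _ dff)) (near_chart_image iy).
apply: near_eq_is_diff dff.
apply: filterS near_i => -[[z a] t] /= iz.
by have [_] := chart_image_inv iz.
Qed.

(** In coordinates the prolongation is [z |-> (z, grad (phi i) z, phi i z)] near the point; the
    middle slot of its differential is the Hessian applied to [v]. *)
Lemma tangent_map_prolongation x v (i := chart_at (atlas M) x)
    (y := chart_map i x) :
  tangent_map (atlas M) (extended_charts M) (first_prolongation Phi) (x, v) =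
  (first_prolongation Phi x,
   (v, 'd (grad (phi i)) y v, dot v (grad (phi i) y))).
Proof.
have iy : chart_image i y by apply: chart_image_map; exact: chart_dom_self.
rewrite /tangent_map /=; congr (_, _); rewrite -/i -/y.
have dphi : differentiable (phi i) y by apply: Phi_diff.
have dg : differentiable (grad (phi i)) y.
  exact: smooth_on_grad_diff (Phi_smooth i) iy.
have dp : is_diff y (fun z => (z, grad (phi i) z, phi i z))
    (fun v => (v, 'd (grad (phi i)) y v, 'd (phi i) y v)).
  apply: is_diff_pair (differentiableP dphi).
  exact: is_diff_pair (is_diff_id y) (differentiableP dg).
set f := _ \o _ \o _.
have [_ ->] : is_diff y f (fun v => (v, 'd (grad (phi i)) y v, 'd (phi i) y v)).
  apply: near_eq_is_diff dp; apply: filterS (near_chart_image iy) => z iz.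
  have [ip zE] := chart_image_inv iz.
  by rewrite /f /= -grad_in_chart// zE.
by rewrite diff_grad.
Qed.

(** The left-hand side of the Hamilton-Jacobi equation, as a function on [M]. *)
Let G p := Psi (first_prolongation Phi p).

Let G_in_chart i y : chart_image i y ->
  \forall z \near y, h i (z, grad (phi i) z) = (G \o chart_inv i) z.
Proof.
move=> /near_chart_image; apply: filterS => z iz.
by rewrite /h section_in_chart.
Qed.

Lemma hamiltonian_along_prolongation_diff : differentiable_on_manifold G.
Proof.
move=> i y iy.
have dh := generic_hamiltonian_diff iy.
by have [] := near_eq_is_diff (G_in_chart iy) (is_diff_along_grad (Phi_smooth i) iy dh).
Qed.

(** Only the middle components can disagree. By [grad_along_grad], their difference is the gradient
    of [G] in the selected chart. *)
Lemma prolongation_relatedP x :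
  evolution_field Psi (first_prolongation Phi x) =
  tangent_map (atlas M) (extended_charts M) (first_prolongation Phi)
    (projected_field Psi Phi x) <->
  differential G x = 0.
Proof.
rewrite evolution_field_prolongation projected_field_prolongation.
rewrite tangent_map_prolongation.
set i := chart_at _ x; set y := chart_map i x.
have iy : chart_image i y by apply: chart_image_map; exact: chart_dom_self.
rewrite /differential -/i -/y -(near_eq_grad (G_in_chart iy)).
have oi : open (chart_image i) by apply: (@chart_image_open _ _ _ _ (atlas_smooth M)).
have -> : grad (fun z => h i (z, grad (phi i) z)) y =
    partial_x i y + 'd (grad (phi i)) y (partial_a i y).
  exact: grad_along_grad oi (Phi_smooth i) iy (generic_hamiltonian_diff iy).
have dotC : dot (grad (phi i) y) (partial_a i y) = dot (partial_a i y) (grad (phi i) y).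
  by apply: eq_bigr => l _; rewrite mulrC.
rewrite dotC; split=> [[<-]|/eqP]; first by rewrite subrr.
by rewrite addrC addr_eq0 => /eqP ->.
Qed.

End generic.

(** * Antisymmetry of the bivector and the equivalence *)

(** A 1 by 1 matrix equals its transpose, which antisymmetry turns into its negative; a real number
    equal to its negative is 0. *)
Lemma antisymmetric_hamiltonian_vector (R : realType) n (M : manifold R n)
    (L : bivector_field M) (F : M -> R) p :
  (L p)^T = - L p -> dot (differential F p) (hamiltonian_vector L F p) = 0.
Proof.
move=> LT; apply/eqP; rewrite -[_ == 0](mulrn_eq0 _ 2) mulr2n.
rewrite dot_mulmx /hamiltonian_vector trmx_mul trmxK mulmxA.
set g := differential F p.
have E : (g *m L p *m g^T) 0 0 = - (g *m L p *m g^T) 0 0.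
  rewrite -[in LHS](trmxK (g *m L p *m g^T)) mxE !trmx_mul trmxK LT.
  by rewrite mulNmx mulmxN mxE mulmxA.
by rewrite {1}E addNr.
Qed.

Unset Implicit Arguments.
Set Strict Implicit.

Theorem proposition4p4 (R : realType) (n : nat) (M : manifold R n)
    (L : bivector_field M) (E S : M -> R) (Xi : cotangent M -> R) (estar : R)
    (M_connected : connected [set: M])
    (L_poisson : is_poisson L)
    (E_smooth : smooth_function (atlas M) E)
    (S_smooth : smooth_function (atlas M) S)
    (S_concave : concave_in_charts S)
    (Xi_smooth : smooth_function (cotangent_charts M) Xi)
    (Xi_dissipation : is_dissipation_potential Xi)
    (LS_0 : forall x : M, hamiltonian_vector L S x = 0)
    (XSE_0 : forall x : M, apply_field (dissipative_vector Xi S) E x = 0)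
    (XE_0 : forall x : M, dissipative_vector Xi E x = 0)
    (estar_neq0 : estar != 0) :
  let Phi := thermodynamic_potential E S estar in
  let Psi := extend_function (generic_hamiltonian L Xi Phi estar) in
  (forall x : M,
     evolution_field Psi (first_prolongation Phi x) =
     tangent_map (atlas M) (extended_charts M) (first_prolongation Phi)
       (projected_field Psi Phi x))
  <->
  (exists epsilon : R, forall x : M,
     Psi (first_prolongation Phi x) = - Xi (x, differential Phi x) /\
     - Xi (x, differential Phi x) = epsilon).
Proof.
move=> Phi Psi.
have Phi_smooth : smooth_function (atlas M) Phi.
  move=> i; apply: (smooth_on_lin estar _ (S_smooth i) (E_smooth i)).
  exact: (@chart_image_open _ _ _ _ (atlas_smooth M)).
have L_smooth := @poisson_smooth _ _ _ _ L_poisson.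
have relP := prolongation_relatedP estar L_smooth Phi_smooth Xi_smooth.
have PsiE x : Psi (first_prolongation Phi x) = - Xi (x, differential Phi x).
  rewrite /Psi /extend_function /generic_hamiltonian /=.
  rewrite antisymmetric_hamiltonian_vector ?mulr0 ?sub0r//.
  exact: (@poisson_antisymmetric _ _ _ _ L_poisson).
split=> [related|[eps Psi_eps] x].
  have d0 x := (relP x).1 (related x).
  have dG := hamiltonian_along_prolongation_diff estar L_smooth Phi_smooth Xi_smooth.
  have cst := differential0_cst M_connected dG d0.
  have [[x0 _]|M0] := pselect (exists x : M, True).
    exists (Psi (first_prolongation Phi x0)) => x; split; first exact: PsiE.
    by rewrite -PsiE; apply: cst.
  (* An empty manifold offers no point at which to read off the constant, so 0 is chosen and the
     claim is vacuous. *)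
  by exists 0 => x; case: M0; exists x.
apply/relP; rewrite /differential.
set F := _ \o _.
(* The equality holds on the whole coordinate space, since [chart_inv] always returns a point of
   [M], where the hypothesis applies. *)
have -> : F = cst eps.
  by apply/funext => y; have [E1 E2] := Psi_eps (chart_inv (chart_at (atlas M) x) y);
    rewrite -E2 -E1.
exact: grad_cst.
Qed.
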